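(* A configuration $\lambda$ is convex, i.e. $\lambda_i-\lambda_{i+1}\ge\lambda_{i+1}-\lambda_{i+2}\ge0$ for all $i\ge1$, if and only if there exists a well-behaved function $\sigma$ such that $\lambda$ is a stable configuration of $\sigma$-Bulgarian solitaire.
   Context: A configuration of $n$ cards is an integer partition $\lambda=(\lambda_1\ge\lambda_2\ge\cdots\ge\lambda_\ell>0)$ of a positive integer $n$ (pile sizes sorted in weakly decreasing order), extended by $\lambda_i=0$ for $i>\ell$. A function $\sigma$ from the positive integers to the nonnegative integers with $\sigma(h)\le h$ for all $h$ is well-behaved if $\sigma(1)=1$, $\sigma(h)$ is non-decreasing in $h$, and $\bar\sigma(h):=h-\sigma(h)$ is non-decreasing in $h$. In a move of $\sigma$-Bulgarian solitaire, $\sigma(h)$ cards are picked from each nonempty pile of size $h$, all picked cards together form one new pile, and the resulting piles are sorted in weakly decreasing order (empty piles being discarded). A configuration is stable if a move leaves it unchanged. *)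

(* Defs.v *)
From mathcomp Require Import all_boot all_order all_algebra.

Set Implicit Arguments.
Unset Strict Implicit.
Unset Printing Implicit Defensive.

Definition is_config (n : nat) (lam : seq nat) : Prop :=
  [/\ sorted geq lam, all (fun h => 0 < h) lam & sumn lam = n].

(* Indices start at 1; beyond the last pile the value is 0.
   The value at index 0 is meaningless. *)
Definition pile (lam : seq nat) (i : nat) : nat := nth 0 lam i.-1.

(* The differences are taken in int, where subtraction is not truncated. *)
Definition convex (lam : seq nat) : Prop :=
  forall i : nat, 0 < i ->
    (((pile lam i.+1)%:Z - (pile lam i.+2)%:Z
        <= (pile lam i)%:Z - (pile lam i.+1)%:Z)%R
     /\ (0 <= (pile lam i.+1)%:Z - (pile lam i.+2)%:Z)%R).

(* sigma is a function on the positive integers: its value at 0 is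
   unconstrained, and is never used because piles are nonempty. *)
Definition well_behaved (sigma : nat -> nat) : Prop :=
  [/\ forall h, 0 < h -> sigma h <= h,
      sigma 1 = 1,
      forall h k, 0 < h -> h <= k -> sigma h <= sigma k
    & forall h k, 0 < h -> h <= k -> h - sigma h <= k - sigma k].

Definition move (sigma : nat -> nat) (lam : seq nat) : seq nat :=
  sort geq [seq h <- sumn [seq sigma h | h <- lam]
                     :: [seq h - sigma h | h <- lam] | 0 < h].

Definition stable (sigma : nat -> nat) (lam : seq nat) : Prop :=
  move sigma lam = lam.

(* Main.v *)
(** If [lam] is stable then, as [sigma h > 0] for [h > 0], the largest pile can
    only be the new one; since [h - sigma h] is non-decreasing, the remaining
    piles are already sorted, so stability says exactly that
    [lam_i - sigma lam_i = lam_(i+1)], i.e. [sigma] maps each pile to its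
    difference with the next one, and convexity is monotonicity of [sigma].
    Conversely, for convex [lam] these prescribed values extend to the
    function [h |-> max_i (min h lam_i - lam_(i+1))] (truncated subtraction),
    a maximum of functions that are non-decreasing and 1-Lipschitz. *)
Require Import Defs.
From mathcomp Require Import all_boot all_order all_algebra.
From mathcomp Require Import zify.

Lemma geq_trans : transitive geq.
Proof. by move=> y x z /= hxy hyz; apply: leq_trans hyz hxy. Qed.

Lemma sorted_geq_nth (s : seq nat) : sorted geq s ->
  forall i j, i <= j -> nth 0 s j <= nth 0 s i.
Proof.
move=> s_sorted i j le_ij; have [lt_js|] := ltnP j (size s); last first.
  by move=> /(nth_default 0) ->.
apply: (sorted_leq_nth geq_trans leqnn 0 s_sorted) => //.
by rewrite inE (leq_ltn_trans le_ij).
Qed.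

Lemma sorted_geq_zeros (s : seq nat) : sorted geq s ->
  exists m, s = [seq h <- s | 0 < h] ++ nseq m 0.
Proof.
elim: s => [|x s IHs] /=; first by exists 0.
move=> xs; have [m s_eq] := IHs (path_sorted xs).
case: x xs => [|x] xs; last by exists m; rewrite /= -s_eq.
have s0 : s = nseq (size s) 0.
  apply/all_pred1P/allP => h hs.
  by have /allP/(_ h hs) := order_path_min geq_trans xs; case: h {hs}.
by exists (size s).+1; rewrite s0 filter_nseq size_nseq.
Qed.

(** Sortedness makes every consecutive difference nonnegative, so truncated subtraction agrees with
    subtraction in [int] and the second inequality of [convex] is automatic. *)
Lemma convexE (lam : seq nat) : sorted geq lam -> convex lam <->
  forall i, nth 0 lam i.+1 - nth 0 lam i.+2 <= nth 0 lam i - nth 0 lam i.+1.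
Proof.
move=> /sorted_geq_nth lam_geq; split=> cvx i.
  case: (cvx i.+1 isT); rewrite /pile /=; lia.
case: i => // i _; rewrite /pile /=; have := cvx i.
have := lam_geq i i.+1 (leqnSn i); have := lam_geq i.+1 i.+2 (leqnSn _); lia.
Qed.

Lemma well_behaved_gt0 (sigma : nat -> nat) : well_behaved sigma ->
  forall h, 0 < h -> 0 < sigma h.
Proof. by case=> _ s1 s_mono _ h h_gt0; rewrite -s1 s_mono. Qed.

Lemma sumn_split (sigma : nat -> nat) (s : seq nat) :
    {in s, forall h, sigma h <= h} ->
  sumn [seq sigma h | h <- s] + sumn [seq h - sigma h | h <- s] = sumn s.
Proof.
move=> sigma_le; rewrite !sumnE !big_map -big_split /=.
by apply: eq_big_seq => h /sigma_le; apply: subnKC.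
Qed.

(** The final [0] records a pile that is emptied: a move creates one new pile, so a stable
    configuration must lose exactly one. *)
Lemma stableE (sigma : nat -> nat) (lam : seq nat) :
    well_behaved sigma -> lam != [::] -> sorted geq lam ->
    all (fun h => 0 < h) lam ->
  stable sigma lam <-> [seq h - sigma h | h <- lam] = rcons (behead lam) 0.
Proof.
move=> sigma_wb; have sigma_gt0 := @well_behaved_gt0 _ sigma_wb.
case: sigma_wb => sigma_le _ _ sigmaC_mono.
case: lam => // x t _ lam_sorted lam_gt0.
pose lam := x :: t; pose rest := [seq h - sigma h | h <- lam].
have gt0 : {in lam, forall h, 0 < h} by apply/allP.
have le_x : {in t, forall h, h <= x}.
  exact/allP/(order_path_min geq_trans).
have x_gt0 : 0 < x by apply: gt0; rewrite mem_head.
have rest_sorted : sorted geq rest.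
  apply: homo_sorted_in lam_gt0 lam_sorted => h k /= _ k_gt0.
  exact: sigmaC_mono.
(* Strictness comes from [sigma k > 0]; hence a pile of size [x] after the move can only be the new
   one. *)
have lt_x h : h \in rest -> h < x.
  case/mapP=> k k_lam ->; have := sigma_gt0 k (gt0 k k_lam).
  have: k <= x by move: k_lam; rewrite inE => /predU1P[->|/le_x].
  by have := gt0 k k_lam; lia.
have sum_split : sumn [seq sigma h | h <- lam] + sumn rest = sumn lam.
  by apply: sumn_split => h /gt0; apply: sigma_le.
split=> [lam_stable | rest_eq]; last first.
  (* Cards are conserved, and [rest] sums to the total of [t], which leaves [x] for the new pile. *)
  have new_x : sumn [seq sigma h | h <- lam] = x.
    by move: sum_split; rewrite /rest rest_eq sumn_rcons /=; lia.
  rewrite /stable /move new_x rest_eq /= x_gt0 filter_rcons /=.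
  have /all_filterP -> : all (fun h => 0 < h) t by case/andP: lam_gt0.
  exact: (sorted_sort geq_trans).
have : x \in move sigma lam by rewrite lam_stable mem_head.
rewrite mem_sort mem_filter inE x_gt0 andTb.
case/predU1P=> [/esym new_x|/lt_x]; last by rewrite ltnn.
have x_sorted : sorted geq (x :: [seq h <- rest | 0 < h]).
  rewrite /sorted path_min_sorted; first exact: (sorted_filter geq_trans).
  by apply/allP => h; rewrite mem_filter => /andP[_ /lt_x/ltnW].
have t_eq : [seq h <- rest | 0 < h] = t.
  suff /(congr1 behead) : x :: [seq h <- rest | 0 < h] = x :: t by [].
  rewrite -(sorted_sort geq_trans x_sorted) -[RHS]lam_stable /move new_x.
  by rewrite [in RHS]/= x_gt0.
have [m] := sorted_geq_zeros _ rest_sorted.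
(* Comparing lengths: [rest] has one entry more than [t]. *)
rewrite t_eq => rest_eq; have m1 : 1 = m.
  apply: (@addnI (size t)); rewrite addn1 -[m in RHS](size_nseq m 0).
  by rewrite -size_cat -rest_eq size_map.
by rewrite [LHS]rest_eq -m1 cats1.
Qed.

Definition max_slope (lam : seq nat) (h : nat) : nat :=
  \max_(i < size lam) (minn h (nth 0 lam i) - nth 0 lam i.+1).

Lemma max_slope_well_behaved (lam : seq nat) : lam != [::] ->
  all (fun h => 0 < h) lam -> well_behaved (max_slope lam).
Proof.
move=> lam_neq0 lam_gt0; have le_h h : max_slope lam h <= h.
  by apply/bigmax_leqP => i _; lia.
split=> [h _||h k _ le_hk|h k _ le_hk]; first exact: le_h.
- apply/eqP; rewrite eqn_leq le_h /=.
  (* The last pile is followed by the default value 0, so its term at [h = 1] is [minn 1] of a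
     positive number, that is 1. *)
  have last_lt : (size lam).-1 < size lam by case: (lam) lam_neq0.
  apply: leq_trans (leq_bigmax (Ordinal last_lt)) => /=.
  have := allP lam_gt0 _ (mem_nth 0 last_lt).
  rewrite prednK ?(leq_ltn_trans _ last_lt) // (nth_default 0 (leqnn _)).
  by rewrite subn0 leq_min.
- apply/bigmax_leqP => i _; apply: leq_trans (leq_bigmax i); lia.
(* Each term grows by at most [k - h], hence so does the maximum. *)
- have : max_slope lam k <= max_slope lam h + (k - h).
    apply/bigmax_leqP => i _.
    have : minn h (nth 0 lam i) - nth 0 lam i.+1 <= max_slope lam h.
      exact: leq_bigmax i.
    by lia.
  by have := le_h h; have := le_h k; lia.
Qed.

(** The term of index [i] attains the value. A term with [j >= i] is the difference at [j], at most
    that at [i] by convexity; a term with [j < i] truncates to 0, as pile [j.+1] is at least pile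
    [i]. *)
Lemma max_slope_nth (lam : seq nat) : sorted geq lam -> convex lam ->
  forall i, i < size lam ->
  max_slope lam (nth 0 lam i) = nth 0 lam i - nth 0 lam i.+1.
Proof.
move=> lam_sorted /(convexE _ lam_sorted) cvx i lt_i.
have lam_geq := sorted_geq_nth _ lam_sorted.
have slope_geq : {homo (fun j => nth 0 lam j - nth 0 lam j.+1) :
    j k / j <= k >-> k <= j}.
  exact: homo_leq leqnn geq_trans cvx.
apply/eqP; rewrite eqn_leq; apply/andP; split; last first.
  by apply: leq_trans (leq_bigmax (Ordinal lt_i)); rewrite minnn.
apply/bigmax_leqP => j _; have [le_ij|lt_ji] := leqP i j.
  by have := slope_geq _ _ le_ij; have := lam_geq _ _ le_ij; lia.
by have := lam_geq _ _ lt_ji; lia.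
Qed.

Theorem lemma2 (n : nat) (n_gt0 : 0 < n) (lam : seq nat)
    (lam_config : is_config n lam) :
  convex lam <->
  exists sigma : nat -> nat, well_behaved sigma /\ stable sigma lam.
Proof.
case: lam_config => lam_sorted lam_gt0 lam_sum.
have lam_neq0 : lam != [::] by case: (lam) lam_sum n_gt0 => //= <-.
have gt0 i : i < size lam -> 0 < nth 0 lam i.
  by move=> lt_i; apply: (allP lam_gt0); apply: mem_nth.
(* The appended 0 coincides with the default value, so no bound on [i] is needed. *)
have nth_next i : nth 0 (rcons (behead lam) 0) i = nth 0 lam i.+1.
  by rewrite nth_rcons nth_behead if_same; case: ltngtP => // [le|->];
    rewrite nth_default //; move: le; rewrite size_behead; lia.
split=> [cvx | [sigma [sigma_wb lam_stable]]].
  have slope_wb := max_slope_well_behaved _ lam_neq0 lam_gt0.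
  exists (max_slope lam); split=> //; apply/stableE => //.
  have size_next : size (rcons (behead lam) 0) = size lam.
    by rewrite size_rcons size_behead prednK // lt0n size_eq0.
  apply: (@eq_from_nth _ 0) => [|i]; rewrite size_map ?size_next // => lt_i.
  rewrite (nth_map 0) // nth_next max_slope_nth //.
  by rewrite subKn //; apply: sorted_geq_nth.
apply/convexE => // i.
(* Past the last pile the smaller difference is 0; otherwise both piles are nonempty and [sigma]
   gives both differences. *)
have [lt_i|le_i] := ltnP i.+1 (size lam); last first.
  by rewrite (nth_default 0 le_i) (nth_default 0 (leqW le_i)) subnn.
have sigma_nth j : j < size lam ->
    nth 0 lam j - nth 0 lam j.+1 = sigma (nth 0 lam j).
  move=> lt_j; move/stableE: lam_stable.
  move=> /(_ sigma_wb lam_neq0 lam_sorted lam_gt0).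
  move=> /(congr1 (fun s => nth 0 s j)); rewrite (nth_map 0) // nth_next => <-.
  by case: sigma_wb => sigma_le _ _ _; rewrite subKn // sigma_le ?gt0.
rewrite !sigma_nth //; last exact: ltnW.
case: sigma_wb => _ _ sigma_mono _; apply: sigma_mono; first exact: gt0.
exact: sorted_geq_nth.
Qed.
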